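(* Let $\lambda_1,\dots,\lambda_N\in(0,1)$ and let $p=(p_1,\dots,p_N)$ be a probability vector with $p_i>0$ for all $i$. For $\alpha>0$ and $q\in\mathbb R$ let $P_\alpha(q)$ be the unique real solution of $\sum_{i=1}^N\lambda_i^{P_\alpha(q)}(p_ie^\alpha)^q=1$, and let $s_0=P_\alpha(0)$, i.e. $\sum_{i=1}^N\lambda_i^{s_0}=1$. Then for every $\alpha>0$ $$\inf_{q\in[0,1]}P_\alpha(q)=\begin{cases}P_\alpha(1), & \text{if }\alpha\le-\sum_{i=1}^N\lambda_i^{P_\alpha(1)}p_ie^\alpha\log p_i,\\[2pt] \inf_{q\in\mathbb R}P_\alpha(q), & \text{if }-\sum_{i=1}^N\lambda_i^{P_\alpha(0)}\log p_i>\alpha>-\sum_{i=1}^N\lambda_i^{P_\alpha(1)}p_ie^\alpha\log p_i,\\[2pt] P_\alpha(0)=s_0, & \text{otherwise.}\end{cases}$$ Moreover, the map $\alpha\mapsto\inf_{q\in[0,1]}P_\alpha(q)$ is continuous, and it is strictly smaller than $s_0$ whenever $-\sum_{i=1}^N\lambda_i^{s_0}\log p_i>\alpha$.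
   Context: Here $\lambda_i$ are the contraction ratios of an iterated function system of similarities satisfying the open set condition, with attractor $\Lambda$, and $s_0=\dim_H\Lambda$; only the numbers $\lambda_i$, $p_i$ enter the statement. *)

(* Defs.v *)
From mathcomp Require Import all_boot all_order all_algebra.
From mathcomp Require Import all_classical all_reals all_analysis.
From mathcomp Require Import ring lra.

Set Implicit Arguments.
Unset Strict Implicit.
Unset Printing Implicit Defensive.

Import Order.TTheory GRing.Theory Num.Theory.
Import numFieldTopology.Exports numFieldNormedType.Exports.

Local Open Scope classical_set_scope.
Local Open Scope ring_scope.

(* [get] returns a junk value on an empty set and an unspecified element
   otherwise; [pressureP], [pressure_unique], [sim_dimP] and [sim_dim_unique]
   show that under the standing assumptions both definitions below denote the
   unique solution of their equation. *)
Definition pressure (R : realType) (N : nat) (lambda p : 'I_N -> R)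
    (alpha q : R) : R :=
  get [set s : R |
    \sum_(i < N) lambda i `^ s * (p i * expR alpha) `^ q = 1].

Definition sim_dim (R : realType) (N : nat) (lambda : 'I_N -> R) : R :=
  get [set s : R | \sum_(i < N) lambda i `^ s = 1].

Definition inf_pressure (R : realType) (N : nat) (lambda p : 'I_N -> R)
    (D : set R) (alpha : R) : R :=
  inf [set pressure lambda p alpha q | q in D].

Section Moran.
Variables (R : realType) (N : nat) (lambda c : 'I_N -> R).
Hypothesis N_gt0 : (0 < N)%N.
Hypothesis lambda01 : forall i, 0 < lambda i < 1.
Hypothesis c_gt0 : forall i, 0 < c i.

Let F (s : R) : R := \sum_(i < N) lambda i `^ s * c i.

Let lambdaE i s : lambda i `^ s = expR (s * ln (lambda i)).
Proof. by rewrite /powR gt_eqF//; case/andP: (lambda01 i). Qed.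

Let ln_lambda i : ln (lambda i) < 0.
Proof. exact: ln_lt0. Qed.

Lemma moran_decreasing (s t : R) : s < t -> F t < F s.
Proof.
move=> st; apply: ltr_sum.
  by apply/hasP; exists (Ordinal N_gt0) => //; rewrite mem_index_enum.
move=> i _; rewrite ltr_pM2r// !lambdaE ltr_expR.
by rewrite ltr_nM2r.
Qed.

Lemma moran_unique (s t : R) : F s = 1 -> F t = 1 -> s = t.
Proof.
move=> Fs Ft; have [/moran_decreasing|/moran_decreasing|//] := ltgtP s t;
  by rewrite Fs Ft ltxx.
Qed.

Lemma moran_ge0 (s : R) : F s = 1 -> 1 <= F 0 -> 0 <= s.
Proof.
move=> Fs F0; rewrite leNgt; apply/negP => /moran_decreasing.
by rewrite Fs ltNge F0.
Qed.

Let F_continuous : continuous F.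
Proof.
have c1 i : continuous (fun s => lambda i `^ s * c i).
  have -> : (fun s => lambda i `^ s * c i) =
      (fun s => expR (s * ln (lambda i)) * c i).
    by apply/funext => s; rewrite lambdaE.
  move=> x; apply: cvgMr_tmp.
  apply: (@cvg_comp _ _ _ (fun s => s * ln (lambda i)) expR).
    by apply: cvgMr_tmp; exact: cvg_id.
  exact: continuous_expR.
have -> : F = \sum_(i < N) (fun s => lambda i `^ s * c i).
  by apply/funext => s; rewrite fct_sumE.
elim/big_ind : _ => [x|f g cf cg x|i _]; [exact: cvg_cst| |exact: c1].
by apply: cvgD; [exact: cf|exact: cg].
Qed.

Lemma moran_exists : exists s : R, F s = 1.
Proof.
pose i0 := Ordinal N_gt0.
pose a := - ln (c i0) / ln (lambda i0).
have Fa : 1 <= F a.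
  rewrite /F (bigD1 i0)//= lambdaE /a divfK ?lt_eqF// expRN lnK ?posrE//.
  rewrite mulVf ?gt_eqF// lerDl sumr_ge0// => i _.
  by rewrite mulr_ge0 ?powR_ge0 ?ltW.
pose u i := `|ln (N%:R * c i) / ln (lambda i)|.
pose b := `|a| + \sum_(i < N) u i.
have u0 i : 0 <= u i by exact: normr_ge0.
have ab : a <= b by rewrite (le_trans (ler_norm a))// lerDl sumr_ge0.
have Nc i : 0 < N%:R * c i by rewrite mulr_gt0// ltr0n.
have ub i : - (ln (N%:R * c i) / ln (lambda i)) <= b.
  rewrite (@le_trans _ _ (u i))//; first by rewrite /u -normrN ler_norm.
  by rewrite /b (bigD1 i)//= addrCA lerDl addr_ge0// sumr_ge0.
have Fb : F b <= 1.
  have -> : 1 = \sum_(i < N) (N%:R^-1 : R).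
    by rewrite sumr_const card_ord -[RHS]mulr_natr mulVf// pnatr_eq0 -lt0n.
  rewrite /F; apply: ler_sum => j _.
  rewrite -(ler_pM2l (_ : 0 < N%:R :> R)) ?ltr0n//.
  rewrite mulfV ?pnatr_eq0 -?lt0n// mulrCA lambdaE.
  rewrite -[N%:R * c j]lnK ?posrE// -expRD -[X in _ <= X]expR0 ler_expR.
  by move: (ub j); rewrite -mulNr ler_ndivrMr// -lerBrDr sub0r.
have [||s _ Fs] := @IVT R F a b 1 ab.
- exact: continuous_subspaceT.
- by rewrite ge_min le_max Fa Fb orbT.
- by exists s.
Qed.

End Moran.

Section Welldefined.
Variables (R : realType) (N : nat) (lambda p : 'I_N -> R).
Hypothesis lambda01 : forall i, 0 < lambda i < 1.
Hypothesis p_gt0 : forall i, 0 < p i.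
Hypothesis p_sum : \sum_(i < N) p i = 1.

Let N_gt0 : (0 < N)%N.
Proof.
have [N0|//] := posnP N; have := p_sum.
have -> : \sum_(i < N) p i = 0.
  by apply: big1 => -[i iN]; exfalso; rewrite N0 in iN.
by move=> /esym/eqP; rewrite (negbTE (oner_neq0 R)).
Qed.

Let c_gt0 alpha q i : 0 < (p i * expR alpha) `^ q.
Proof. by rewrite powR_gt0// mulr_gt0// expR_gt0. Qed.

Lemma pressureP (alpha q : R) :
  \sum_(i < N) lambda i `^ pressure lambda p alpha q
    * (p i * expR alpha) `^ q = 1.
Proof.
have [s Fs] := moran_exists N_gt0 lambda01 (c_gt0 alpha q).
exact: (@getI _ [set s : R |
  \sum_(i < N) lambda i `^ s * (p i * expR alpha) `^ q = 1] s).
Qed.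

Lemma pressure_unique (alpha q s : R) :
  \sum_(i < N) lambda i `^ s * (p i * expR alpha) `^ q = 1 ->
  s = pressure lambda p alpha q.
Proof.
move=> Fs.
exact: (moran_unique N_gt0 lambda01 (c_gt0 alpha q) Fs (pressureP alpha q)).
Qed.

Lemma sim_dimP : \sum_(i < N) lambda i `^ sim_dim lambda = 1.
Proof.
have [s Fs] := @moran_exists R N lambda (fun=> 1) N_gt0 lambda01 (fun=> ltr01).
apply: (@getI _ [set s : R | \sum_(i < N) lambda i `^ s = 1] s) => /=.
by rewrite -Fs; apply: eq_bigr => i _; rewrite mulr1.
Qed.

Lemma pressure0 (alpha : R) : pressure lambda p alpha 0 = sim_dim lambda.
Proof.
apply/esym/pressure_unique; rewrite -sim_dimP.
by apply: eq_bigr => i _; rewrite powRr0 mulr1.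
Qed.

Lemma sim_dim_unique (s : R) :
  \sum_(i < N) lambda i `^ s = 1 -> s = sim_dim lambda.
Proof.
move=> Fs; rewrite -(pressure0 0); apply: pressure_unique.
by rewrite -Fs; apply: eq_bigr => i _; rewrite powRr0 mulr1.
Qed.

Let pressure_ge0 (alpha q : R) :
  1 <= \sum_(i < N) (p i * expR alpha) `^ q -> 0 <= pressure lambda p alpha q.
Proof.
move=> h; apply: (moran_ge0 N_gt0 lambda01 (c_gt0 alpha q) (pressureP _ _)).
by under eq_bigr do rewrite powRr0 mul1r.
Qed.

(* [inf] is only meaningful on nonempty sets that are bounded below; the next
   two lemmas show that this is so wherever the infima are considered. *)
Lemma has_inf_pressure01 (alpha : R) : 0 < alpha ->
  has_inf [set pressure lambda p alpha q | q in `[0, 1]].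
Proof.
move=> alpha0; split.
  by exists (pressure lambda p alpha 0), 0 => //=; rewrite in_itv/= lexx ler01.
exists 0 => _ [q + <-]; rewrite /= in_itv/= => /andP[q0 q1].
apply: pressure_ge0; rewrite -p_sum; apply: ler_sum => i _.
have p1 : p i <= 1.
  by rewrite -p_sum (bigD1 i)//= lerDl sumr_ge0// => j _; exact: ltW.
have pi_ge0 := ltW (p_gt0 i).
rewrite powRM ?expR_ge0//; apply: (@le_trans _ _ (p i `^ q)).
  by rewrite ger1_powR// p_gt0.
rewrite ler_peMr ?powR_ge0// -(powRr0 (expR alpha)) ler_powR//.
by rewrite -expR0 ler_expR ltW.
Qed.

Lemma has_inf_pressureT (alpha : R) : 0 < alpha ->
  alpha < - \sum_(i < N) lambda i `^ pressure lambda p alpha 0 * ln (p i) ->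
  - \sum_(i < N) lambda i `^ pressure lambda p alpha 1
      * (p i * expR alpha) * ln (p i) < alpha ->
  has_inf [set pressure lambda p alpha q | q in [set: R]].
Proof.
move=> alpha0 lt0 lt1.
have cE q i : (p i * expR alpha) `^ q = expR (q * (ln (p i) + alpha)).
  rewrite /powR gt_eqF ?mulr_gt0 ?expR_gt0//.
  by rewrite lnM ?posrE ?expR_gt0// expRK.
have cge1 q i : 0 <= q * (ln (p i) + alpha) ->
    1 <= \sum_(j < N) (p j * expR alpha) `^ q.
  move=> h; rewrite (bigD1 i)//= cE.
  rewrite (@le_trans _ _ (expR (q * (ln (p i) + alpha))))//.
    by rewrite -expR0 ler_expR.
  by rewrite lerDl sumr_ge0// => j _; rewrite powR_ge0.
have w1 q : \sum_(i < N) lambda i `^ pressure lambda p alpha q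
    * (p i * expR alpha) `^ q * (ln (p i) + alpha)
  = \sum_(i < N) lambda i `^ pressure lambda p alpha q
    * (p i * expR alpha) `^ q * ln (p i) + alpha.
  under eq_bigr do rewrite mulrDr.
  by rewrite big_split/= -mulr_suml pressureP mul1r.
have [j pj] : exists j, ln (p j) + alpha <= 0.
  apply: contrapT => /forallNP h.
  suff : 0 <= \sum_(i < N) lambda i `^ pressure lambda p alpha 0
      * (p i * expR alpha) `^ 0 * (ln (p i) + alpha).
    rewrite w1; under eq_bigr do rewrite powRr0 mulr1.
    by move: lt0; lra.
  apply: sumr_ge0 => i _; rewrite !mulr_ge0 ?powR_ge0//.
  by have /negP := h i; rewrite -ltNge => /ltW.
have [k pk] : exists k, 0 <= ln (p k) + alpha.
  apply: contrapT => /forallNP h.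
  suff : \sum_(i < N) lambda i `^ pressure lambda p alpha 1
      * (p i * expR alpha) `^ 1 * (ln (p i) + alpha) <= 0.
    rewrite w1.
    under eq_bigr do rewrite powRr1 ?mulr_ge0 ?expR_ge0 1?ltW//.
    by move: lt1; lra.
  apply: sumr_le0 => i _.
  rewrite mulr_ge0_le0 ?mulr_ge0 ?powR_ge0//.
  by have /negP := h i; rewrite -ltNge => /ltW.
split; first by exists (pressure lambda p alpha 0), 0.
exists 0 => _ [q _ <-]; apply: pressure_ge0.
have [q0|/ltW q0] := leP 0 q; first by apply: (@cge1 q k); rewrite mulr_ge0.
by apply: (@cge1 q j); rewrite mulr_le0.
Qed.

End Welldefined.

(* Main.v *)
Require Import Defs.
From mathcomp Require Import all_boot all_order all_algebra.
From mathcomp Require Import all_classical all_reals all_analysis.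
From mathcomp Require Import ring lra.

Import Order.TTheory GRing.Theory Num.Theory.
Import numFieldTopology.Exports numFieldNormedType.Exports.

Local Open Scope classical_set_scope.
Local Open Scope ring_scope.

(** Write [G s q] for the sum of the weights
    [exp (s * ln (lambda i) + q * (ln (p i) + alpha))], so that the graph of
    the pressure [P] is the level set [G = 1].

    Since [G] is a sum of exponentials of linear forms, the tangent inequality
    [exp y >= exp x * (1 + (y - x))], summed over [i] at two points of that
    level set, says that [P] lies above a line through [(q, P q)]
    ([pressure_tangent]).  The weights at [(P q, q)] sum to 1 and
    [ln (lambda i) < 0], so the slope of this line has the sign of
    [alpha - A q], where [A q] is the mean of [- ln (p i)] for these weights;
    [A 0] and [A 1] are the two thresholds of the trichotomy.  No derivative of
    the implicit function [P] is needed.  If [alpha <= A 1] the line at 1 makes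
    [P 1] minimal to the left of 1; if [A 0 <= alpha] the line at 0 makes [P 0]
    minimal to the right of 0; and if [A 1 < alpha < A 0] these lines point the
    other way, so that [P] is at least [P 0] before 0 and at least [P 1] after
    1, and the infimum over the whole line is the one over [[0, 1]].

    When [alpha < A 0], the partial derivative of [G] in [q] is negative at
    [(P 0, 0)], hence [G (P 0) q < 1] for some small [q > 0]; as [G] decreases
    in [s], this means [P q < P 0] ([pressure_lt_sim_dim]).

    Finally, raising [alpha] by [h] multiplies each weight by at most [exp h]
    when [0 <= q <= 1], which an increase of [s] by a constant multiple of [h]
    makes up for.  So [P q] is Lipschitz in [alpha], uniformly in
    [q] in [[0, 1]], and this passes to the infimum ([inf_pressure_lipschitz]). *)

Section Pressure.
Variables (R : realType) (N : nat) (lambda p : 'I_N -> R).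
Hypothesis lambda01 : forall i, 0 < lambda i < 1.
Hypothesis p_gt0 : forall i, 0 < p i.
Hypothesis p_sum : \sum_(i < N) p i = 1.

Local Notation P := (pressure lambda p).

Definition weight (alpha s q : R) (i : 'I_N) : R :=
  lambda i `^ s * (p i * expR alpha) `^ q.

Lemma weightE alpha s q i :
  weight alpha s q i = expR (s * ln (lambda i) + q * (ln (p i) + alpha)).
Proof.
have l0 : 0 < lambda i by case/andP: (lambda01 i).
rewrite /weight /powR !gt_eqF ?mulr_gt0 ?expR_gt0// -expRD.
by rewrite lnM ?posrE ?expR_gt0// expRK.
Qed.

Lemma weight_gt0 alpha s q i : 0 < weight alpha s q i.
Proof. by rewrite weightE expR_gt0. Qed.

Lemma ln_lambda_lt0 i : ln (lambda i) < 0.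
Proof. exact: ln_lt0. Qed.

Lemma index_gt0 : (0 < N)%N.
Proof.
rewrite lt0n; apply/eqP => N0; have := oner_neq0 R; rewrite -p_sum.
by rewrite big1 ?eqxx// => -[i iN]; exfalso; rewrite N0 in iN.
Qed.

Lemma sum_weight alpha q : \sum_(i < N) weight alpha (P alpha q) q i = 1.
Proof. exact: pressureP. Qed.

Lemma sum_weight_decreasing alpha q s t : s < t ->
  \sum_(i < N) weight alpha t q i < \sum_(i < N) weight alpha s q i.
Proof.
apply: (moran_decreasing index_gt0 lambda01) => i.
by rewrite powR_gt0// mulr_gt0// expR_gt0.
Qed.

Lemma pressure_lt alpha q s :
  \sum_(i < N) weight alpha s q i < 1 -> P alpha q < s.
Proof.
rewrite -(sum_weight alpha q) => lt_s; rewrite ltNge; apply/negP.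
rewrite le_eqVlt => /predU1P[sP|/(sum_weight_decreasing alpha q)].
  by rewrite sP ltxx in lt_s.
by rewrite ltNge (ltW lt_s).
Qed.

Lemma pressure_le alpha q s :
  \sum_(i < N) weight alpha s q i <= 1 -> P alpha q <= s.
Proof.
rewrite -(sum_weight alpha q) => le_s; rewrite leNgt; apply/negP.
by move=> /(sum_weight_decreasing alpha q); rewrite ltNge le_s.
Qed.

Lemma pressure_ge alpha q s :
  1 <= \sum_(i < N) weight alpha s q i -> s <= P alpha q.
Proof.
rewrite -(sum_weight alpha q) => le_s; rewrite leNgt; apply/negP.
by move=> /(sum_weight_decreasing alpha q); rewrite ltNge le_s.
Qed.

(** Convexity of the exponential, summed over the indices: the sum of the
    weights lies above each of its tangent planes. *)
Lemma sum_weight_tangent alpha s q t r :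
  \sum_(i < N) weight alpha s q i
    + (t - s) * (\sum_(i < N) weight alpha s q i * ln (lambda i))
    + (r - q) * (\sum_(i < N) weight alpha s q i * (ln (p i) + alpha))
  <= \sum_(i < N) weight alpha t r i.
Proof.
rewrite !mulr_sumr -!big_split/=; apply: ler_sum => i _.
rewrite (weightE alpha t r).
have -> : t * ln (lambda i) + r * (ln (p i) + alpha) =
    (s * ln (lambda i) + q * (ln (p i) + alpha)) +
    ((t - s) * ln (lambda i) + (r - q) * (ln (p i) + alpha)) by ring.
rewrite expRD -weightE.
set w := weight _ _ _ _; set x := (X in expR X).
rewrite (_ : _ + _ + _ = w * (1 + x)); last by rewrite /x; ring.
by rewrite ler_pM2l ?weight_gt0// expR_ge1Dx.
Qed.

Lemma sum_weight_slope alpha q :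
  \sum_(i < N) weight alpha (P alpha q) q i * (ln (p i) + alpha) =
  alpha + \sum_(i < N) weight alpha (P alpha q) q i * ln (p i).
Proof.
under eq_bigr do rewrite mulrDr.
by rewrite big_split/= -mulr_suml sum_weight mul1r addrC.
Qed.

(** The slope comes out multiplied by the positive number
    [- \sum_i w i * ln (lambda i)]; only its sign matters. *)
Lemma pressure_tangent alpha q r :
  (r - q) *
    (alpha + \sum_(i < N) weight alpha (P alpha q) q i * ln (p i))
  <= (P alpha r - P alpha q) *
    - \sum_(i < N) weight alpha (P alpha q) q i * ln (lambda i).
Proof.
have := sum_weight_tangent alpha (P alpha q) q (P alpha r) r.
by rewrite !sum_weight sum_weight_slope; lra.
Qed.

Lemma pressure_le_of_slope alpha q r :
  0 <= (r - q) *
    (alpha + \sum_(i < N) weight alpha (P alpha q) q i * ln (p i)) ->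
  P alpha q <= P alpha r.
Proof.
move=> /le_trans/(_ (pressure_tangent alpha q r)).
rewrite pmulr_lge0 ?subr_ge0// -sumrN (bigD1 (Ordinal index_gt0))//=.
have w0 i : 0 < - (weight alpha (P alpha q) q i * ln (lambda i)).
  by rewrite -mulrN mulr_gt0 ?weight_gt0// oppr_gt0 ln_lambda_lt0.
by rewrite ltr_wpDr// sumr_ge0// => i _; exact: ltW.
Qed.

Lemma sum_weight0_ln alpha :
  \sum_(i < N) weight alpha (P alpha 0) 0 i * ln (p i) =
  \sum_(i < N) lambda i `^ P alpha 0 * ln (p i).
Proof. by apply: eq_bigr => i _; rewrite /weight powRr0 mulr1. Qed.

Lemma sum_weight1_ln alpha :
  \sum_(i < N) weight alpha (P alpha 1) 1 i * ln (p i) =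
  \sum_(i < N) lambda i `^ P alpha 1 * (p i * expR alpha) * ln (p i).
Proof.
apply: eq_bigr => i _; rewrite /weight powRr1//.
by rewrite mulr_ge0 ?expR_ge0// ltW.
Qed.

Lemma pressure_min0 alpha q : 0 <=
  q * (alpha + \sum_(i < N) lambda i `^ P alpha 0 * ln (p i)) ->
  P alpha 0 <= P alpha q.
Proof.
by move=> h; apply: pressure_le_of_slope; rewrite subr0 sum_weight0_ln.
Qed.

Lemma pressure_min1 alpha q : 0 <= (q - 1) *
  (alpha + \sum_(i < N) lambda i `^ P alpha 1 * (p i * expR alpha) * ln (p i)) ->
  P alpha 1 <= P alpha q.
Proof. by move=> h; apply: pressure_le_of_slope; rewrite sum_weight1_ln. Qed.

Lemma inf_pressure_eq_min (D : set R) alpha q0 : D q0 ->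
  (forall q, D q -> P alpha q0 <= P alpha q) ->
  inf_pressure lambda p D alpha = P alpha q0.
Proof.
move=> Dq0 min_q0; apply/eqP; rewrite eq_le; apply/andP; split.
  by apply: ge_inf; [exists (P alpha q0) => _ [q /min_q0 ? <-]|exists q0].
by apply: lb_le_inf; [exists (P alpha q0), q0|move=> _ [q /min_q0 ? <-]].
Qed.

Lemma inf_pressure01_le alpha q : 0 < alpha -> 0 <= q <= 1 ->
  inf_pressure lambda p `[0, 1] alpha <= P alpha q.
Proof.
move=> alpha0 q01; apply: ge_inf; last by exists q; rewrite //= in_itv.
by have [] := has_inf_pressure01 lambda01 p_gt0 p_sum alpha0.
Qed.

Lemma le_inf_pressure01 alpha x :
  (forall q, 0 <= q <= 1 -> x <= P alpha q) ->
  x <= inf_pressure lambda p `[0, 1] alpha.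
Proof.
move=> lb; apply: lb_le_inf.
  by exists (P alpha 0), 0; rewrite //= in_itv/= lexx ler01.
by move=> _ [q + <-]; rewrite /= in_itv => /lb.
Qed.

Lemma inf_pressureT alpha : 0 < alpha ->
  alpha < - \sum_(i < N) lambda i `^ P alpha 0 * ln (p i) ->
  - \sum_(i < N) lambda i `^ P alpha 1 * (p i * expR alpha) * ln (p i) < alpha ->
  inf_pressure lambda p `[0, 1] alpha = inf_pressure lambda p [set: R] alpha.
Proof.
move=> alpha0 lt0 lt1; apply/eqP; rewrite eq_le; apply/andP; split.
  apply: lb_le_inf; first by exists (P alpha 0), 0.
  move=> _ [q _ <-].
  have [q0|q0] := leP 0 q; last first.
    apply: le_trans (pressure_min0 alpha q _).
      by apply: inf_pressure01_le; rewrite // lexx ler01.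
    by rewrite nmulr_rge0//; move: lt0; lra.
  have [q1|q1] := leP q 1; first by rewrite inf_pressure01_le// q0.
  apply: le_trans (pressure_min1 alpha q _).
    by apply: inf_pressure01_le; rewrite // ler01 lexx.
  by rewrite pmulr_rge0 ?subr_gt0//; move: lt1; lra.
apply: le_inf_pressure01 => q _; apply: ge_inf; last by exists q.
by have [] := has_inf_pressureT lambda01 p_gt0 p_sum alpha0 lt0 lt1.
Qed.

Lemma continuous_sum_weight alpha s (c : 'I_N -> R) :
  continuous (fun q => \sum_(i < N) weight alpha s q i * c i).
Proof.
have -> : (fun q => \sum_(i < N) weight alpha s q i * c i) =
    \sum_(i < N) (fun q => weight alpha s q i * c i).
  by apply/funext => q; rewrite fct_sumE.
elim/big_ind : _ => [q|f g cf cg q|i _ q]; first exact: cvg_cst.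
  by apply: cvgD; [exact: cf|exact: cg].
have -> : (fun q => weight alpha s q i * c i) =
    (fun q => expR (s * ln (lambda i) + q * (ln (p i) + alpha)) * c i).
  by apply/funext => r; rewrite weightE.
apply: cvgMr_tmp; apply: continuous_comp; last exact: continuous_expR.
by apply: cvgD; [exact: cvg_cst|apply: cvgMr_tmp; exact: cvg_id].
Qed.

(** Negativity of the [q]-derivative at 0 persists nearby by continuity, and the
    tangent plane at a nearby point [q], evaluated at 0, bounds the sum at [q]
    by [1 + q * (a negative number)]. *)
Lemma pressure_lt_sim_dim alpha :
  alpha < - \sum_(i < N) lambda i `^ sim_dim lambda * ln (p i) ->
  exists2 q, 0 <= q <= 1 & P alpha q < sim_dim lambda.
Proof.
have P0 := pressure0 lambda01 p_gt0 p_sum alpha; rewrite -P0 => lt0.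
pose B q := \sum_(i < N) weight alpha (P alpha 0) q i * (ln (p i) + alpha).
have B0 : B 0 < 0.
  by rewrite /B sum_weight_slope sum_weight0_ln; move: lt0; lra.
have [e /= e0 Be] : \forall q \near 0, B q < 0.
  exact: (cvgr_lt (B 0) (continuous_sum_weight _ _ _ 0)).
pose q := Num.min (e / 2) 1.
have q0 : 0 < q by rewrite lt_min divr_gt0//= ltr01.
exists q; first by rewrite ltW//= ge_min lexx orbT.
have Bq : B q < 0.
  apply: Be => /=; rewrite sub0r normrN gtr0_norm//.
  by rewrite gt_min ltr_pdivrMr// ltr_pMr// ltr1n.
apply: pressure_lt.
have := sum_weight_tangent alpha (P alpha 0) q (P alpha 0) 0.
rewrite sum_weight -/(B q) subrr mul0r addr0 sub0r mulNr => h.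
have : q * B q < 0 by rewrite pmulr_rlt0.
by move: h; lra.
Qed.

(** Any [K] with [K * ln (lambda i) <= -1] for all [i] would do. *)
Let K : R := \sum_(i < N) (- ln (lambda i))^-1.

Let Kln_lambda i : K * ln (lambda i) <= -1.
Proof.
have l0 j : 0 < - ln (lambda j) by rewrite oppr_gt0 ln_lambda_lt0.
rewrite -lerN2 opprK -mulrN -ler_pdivrMr// mul1r /K (bigD1 i)//= lerDl.
by rewrite sumr_ge0// => j _; rewrite invr_ge0 ltW.
Qed.

Lemma pressure_nondecreasing q a b : 0 <= q -> a <= b -> P a q <= P b q.
Proof.
move=> q0 ab; apply: pressure_ge; rewrite -(sum_weight a q).
by apply: ler_sum => i _; rewrite !weightE ler_expR lerD2l ler_wpM2l// lerD2l.
Qed.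

(** With [s] raised by [K * (b - a)], each exponent changes by
    [(K * ln (lambda i) + q) * (b - a) <= (-1 + 1) * (b - a)]. *)
Lemma pressure_lipschitz q a b : 0 <= q <= 1 -> a <= b ->
  P b q <= P a q + K * (b - a).
Proof.
move=> /andP[q0 q1] ab; apply: pressure_le; rewrite -(sum_weight a q).
apply: ler_sum => i _; rewrite !weightE ler_expR -subr_ge0.
rewrite (_ : _ - _ = (- (K * ln (lambda i)) - q) * (b - a)); last by ring.
by rewrite mulr_ge0 ?subr_ge0//; have := Kln_lambda i; move: q1; lra.
Qed.

Lemma inf_pressure_lipschitz a b : 0 < a -> a <= b ->
  `|inf_pressure lambda p `[0, 1] a - inf_pressure lambda p `[0, 1] b|
  <= K * (b - a).
Proof.
move=> a0 ab; have b0 := lt_le_trans a0 ab.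
have le_ab : inf_pressure lambda p `[0, 1] a <= inf_pressure lambda p `[0, 1] b.
  apply: le_inf_pressure01 => q q01; apply: (@le_trans _ _ (P a q)).
    exact: inf_pressure01_le.
  by apply: pressure_nondecreasing => //; case/andP: q01.
rewrite ler0_norm ?subr_le0// opprB lerBlDl -lerBlDr.
apply: le_inf_pressure01 => q q01; rewrite lerBlDr.
exact: le_trans (inf_pressure01_le _ _ b0 q01) (pressure_lipschitz _ _ _ q01 ab).
Qed.

Lemma inf_pressure_continuous :
  {within `]0, +oo[, continuous (inf_pressure lambda p `[0, 1])}.
Proof.
rewrite continuous_open_subspace; last exact: interval_open.
move=> a; rewrite inE/= in_itv/= andbT => a0.
have K0 : 0 <= K.
  by apply: sumr_ge0 => i _; rewrite invr_ge0 oppr_ge0 ltW ?ln_lambda_lt0.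
apply/cvgrPdist_le => e e0.
have d0 : 0 < e / (K + 1) by rewrite divr_gt0// ltr_wpDl.
near=> x.
have x0 : 0 < x by near: x; exact: lt_nbhsr.
have ax : K * `|a - x| <= e.
  have : `|a - x| <= e / (K + 1).
    by near: x; apply: cvgr_dist_le => //; exact: cvg_id.
  rewrite ler_pdivlMr ?ltr_wpDl// mulrC mulrDl mul1r; apply: le_trans.
  by rewrite lerDl.
apply: le_trans ax; have [le_ax|/ltW le_xa] := leP a x.
  rewrite (le_trans (inf_pressure_lipschitz _ _ a0 le_ax))//.
  by rewrite ler_wpM2l// -normrN opprB ler_norm.
rewrite distrC (le_trans (inf_pressure_lipschitz _ _ x0 le_xa))//.
by rewrite ler_wpM2l// ler_norm.
Unshelve. all: by end_near.
Qed.

End Pressure.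

Theorem proposition2p2 (R : realType) (N : nat) (lambda p : 'I_N -> R)
    (lambda01 : forall i, 0 < lambda i < 1)
    (p_gt0 : forall i, 0 < p i)
    (p_sum : \sum_(i < N) p i = 1) :
  let P := pressure lambda p in
  let s0 := sim_dim lambda in
  let A0 := fun alpha : R => - \sum_(i < N) lambda i `^ P alpha 0 * ln (p i) in
  let A1 := fun alpha : R =>
    - \sum_(i < N) lambda i `^ P alpha 1 * (p i * expR alpha) * ln (p i) in
  [/\ forall alpha : R, 0 < alpha ->
        inf_pressure lambda p `[0, 1] alpha =
          (if alpha <= A1 alpha then P alpha 1
           else if A1 alpha < alpha < A0 alpha then
             inf_pressure lambda p [set: R] alpha
           else P alpha 0)
        /\ P alpha 0 = s0,
      {within `]0, +oo[, continuous (inf_pressure lambda p `[0, 1])}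
    & forall alpha : R, 0 < alpha ->
        alpha < - \sum_(i < N) lambda i `^ s0 * ln (p i) ->
        inf_pressure lambda p `[0, 1] alpha < s0].

Proof.
move=> P s0 A0 A1; split.
- move=> alpha alpha0; split; last exact: pressure0.
  have [le1|lt1] := leP alpha (A1 alpha).
    apply: inf_pressure_eq_min => [|q]; rewrite /= in_itv/= ?ler01 ?lexx//.
    move=> /andP[_ q1]; apply: pressure_min1 => //.
    by rewrite mulr_le0 ?subr_le0//; move: le1; rewrite /A1; lra.
  case: ifPn => [lt0|]; first exact: inf_pressureT.
  rewrite -leNgt => le0.
  apply: inf_pressure_eq_min => [|q]; rewrite /= in_itv/= ?ler01 ?lexx//.
  move=> /andP[q0 _]; apply: pressure_min0 => //.
  by rewrite mulr_ge0//; move: le0; rewrite /A0; lra.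
- exact: inf_pressure_continuous.
- move=> alpha alpha0 lt0.
  have [q q01] := pressure_lt_sim_dim _ _ _ _ lambda01 p_gt0 p_sum _ lt0.
  by apply: le_lt_trans; apply: inf_pressure01_le.
Qed.
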